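(* Consider a unit disk with an exit placed at an unknown point of its boundary and two robots starting at the centre in the face-to-face model. For every (deterministic) evacuation algorithm, the worst-case evacuation time is at least $3+\frac{\pi}{6}+\sqrt{3}\approx 5.255$.
   Context: Two robots start at time $0$ at the centre of a disk of radius $1$; each can move anywhere in the disk with speed at most $1$ and knows the other's deterministic algorithm; a robot learns the location of the exit only when it is at that point; robots can exchange information only when they are at the same point at the same time (face-to-face model). For a given exit position the evacuation time is the time when both robots have reached the exit; the worst-case evacuation time is the supremum over all exit positions on the boundary circle. *)

(* Defs.v *)
From HB Require Import structures.
From mathcomp Require Import all_boot all_order all_algebra.
From mathcomp Require Import all_classical all_reals all_analysis.

Set Implicit Arguments.
Unset Strict Implicit.
Unset Printing Implicit Defensive.

Import Order.TTheory GRing.Theory Num.Theory.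

Local Open Scope classical_set_scope.
Local Open Scope ring_scope.

Section Evacuation.
Context {R : realType}.

(* The library norm on [R * R] is the sup norm, hence an explicit distance. *)
Definition point : Type := (R * R)%type.

Definition origin : point := (0, 0).

Definition dist (p q : point) : R :=
  Num.sqrt ((p.1 - q.1) ^+ 2 + (p.2 - q.2) ^+ 2).

Definition disk : set point := [set p | dist origin p <= 1].

Definition circle : set point := [set p | dist origin p = 1].

Definition robot : Type := bool.

(* Positions of both robots; only times [0 <= t] are meaningful. *)
Definition motion : Type := robot -> R -> point.

Definition meet_at (r : motion) (t : R) : Prop :=
  0 <= t /\ r true t = r false t.

Definition finds_at (e : point) (r : motion) (j : robot) (t : R) : Prop :=
  0 <= t /\ r j t = e.

(* All the information available to a robot at some time: the sightings of the
   exit it knows of (who, when, where) and the times at which it met the other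
   robot.  Positions are not recorded, since for fixed deterministic strategies
   they are determined by these observations. *)
Record knowledge : Type := Knowledge {
  sightings : set (robot * R * point);
  meetings : set R }.

(* At time [t], robot [i] knows its own sightings up to [t], and those the
   other robot had made by the time [m <= t] of some meeting. *)
Definition knowledge_at (e : point) (r : motion) (i : robot) (t : R) :
    knowledge :=
  Knowledge
    [set x : robot * R * point | [/\ x.2 = e, finds_at e r x.1.1 x.1.2 &
       (x.1.1 = i /\ x.1.2 <= t) \/
       (exists m : R, [/\ meet_at r m, x.1.2 <= m & m <= t])]]
    [set m : R | meet_at r m /\ m <= t].

(* [s t k u] is the position at which a robot having knowledge [k] at time [t]
   plans to be at the time [u >= t], as long as it learns nothing new. *)
Definition strategy : Type := R -> knowledge -> R -> point.

(* Obeying a strategy means following, from every time [t] on, the plan made at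
   time [t] during some positive amount of time.  New information always has
   a first time of arrival (exit sightings and meetings form closed sets of
   times), so that plans can be followed up to that time.  Merely asking the
   position at [t] to be a function of the knowledge before [t] would be too
   weak in continuous time: two robots staying together could then behave
   differently for different exits right after time 0, without any of them
   having been at the exit, as their pattern of meetings would itself serve as
   the distinguishing information. *)
Definition obeys (s : strategy) (e : point) (r : motion) (i : robot) : Prop :=
  forall t : R, 0 <= t ->
    exists2 d : R, 0 < d &
      forall u : R, t <= u <= t + d -> r i u = s t (knowledge_at e r i t) u.

Definition execution (s : robot -> strategy) (e : point) (r : motion) : Prop :=
  forall i : robot,
    [/\ r i 0 = origin,
        forall t : R, 0 <= t -> disk (r i t),
        forall t u : R, 0 <= t -> 0 <= u -> dist (r i t) (r i u) <= `|t - u| &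
        obeys (s i) e r i].

(* [motion_of e] is only relevant when [e] is on the circle. *)
Record algorithm : Type := Algorithm {
  strategy_of : robot -> strategy;
  motion_of : point -> motion;
  motion_ofP : forall e : point, circle e ->
    execution strategy_of e (motion_of e) }.

(* [+oo] when some robot never reaches the exit. *)
Definition evacuation_time (e : point) (r : motion) : \bar R :=
  ereal_inf [set T%:E | T in [set T : R |
    forall i : robot, exists2 t : R, t <= T & finds_at e r i t]].

Definition worst_case_time (A : algorithm) : \bar R :=
  ereal_sup [set evacuation_time e (motion_of A e) | e in circle].

End Evacuation.

Arguments point R : clear implicits.
Arguments motion R : clear implicits.
Arguments knowledge R : clear implicits.
Arguments strategy R : clear implicits.
Arguments algorithm R : clear implicits.

(* Main.v *)
Require Import Defs.
From mathcomp Require Import all_boot all_order all_algebra.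
From mathcomp Require Import all_classical all_reals all_analysis.
From mathcomp Require Import lra zify.

(** Let [tau e] be the time at which the exit [e] is first found when it is at
    [e], and [rho e] the robot that finds it.  Two runs coincide until one of
    the two exits is found; so if [rho e = rho f], then
    [dist e f <= `|tau e - tau f|].  Now let [tau e <= tau f].  If the finder
    of [e] has no time to reach [f] by the time [tau f], then it cannot inform
    the finder of [f] before [tau f] either, and with exit [e] that robot is
    still at [f] at time [tau f]; so it reaches [e] at time
    [tau f + dist e f] or later.  These inequalities are all that is needed
    about the runs: before time [c < 1 + pi / 6] the robots visit too little of
    the circle to meet all inscribed regular hexagons, and on the vertices of
    an unvisited hexagon the inequalities force an evacuation time of at least
    [c + 2 + sqrt 3]. *)

Set Implicit Arguments.
Unset Strict Implicit.
Unset Printing Implicit Defensive.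

Import Defs.
Import numFieldNormedType.Exports.
Import Order.TTheory GRing.Theory Num.Theory.

Local Open Scope classical_set_scope.
Local Open Scope ring_scope.

(** * The Euclidean distance *)

Lemma distE (R : realType) (p q : point R) :
  dist p q ^+ 2 = (p.1 - q.1) ^+ 2 + (p.2 - q.2) ^+ 2.
Proof. by rewrite sqr_sqrtr // addr_ge0 ?sqr_ge0. Qed.

Lemma dist_ge0 (R : realType) (p q : point R) : 0 <= dist p q.
Proof. exact: sqrtr_ge0. Qed.

Lemma distC (R : realType) (p q : point R) : dist p q = dist q p.
Proof. by congr Num.sqrt; rewrite -[p.1 - _]opprB -[p.2 - _]opprB !sqrrN. Qed.

Lemma distxx (R : realType) (p : point R) : dist p p = 0.
Proof. by rewrite /dist !subrr expr0n addr0 sqrtr0. Qed.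

Lemma dist_eq0 (R : realType) (p q : point R) : dist p q <= 0 -> p = q.
Proof.
move=> d0; have /eqP := distE p q.
have -> : dist p q = 0 by apply/eqP; rewrite eq_le d0 dist_ge0.
rewrite expr0n eq_sym paddr_eq0 ?sqr_ge0// !sqrf_eq0 !subr_eq0.
by case: p q {d0} => [? ?] [? ?] /= /andP[/eqP-> /eqP->].
Qed.

(** Squaring reduces this to the Cauchy-Schwarz inequality, which Lagrange's identity proves. *)
Lemma dist_triangle (R : realType) (q p r : point R) :
  dist p r <= dist p q + dist q r.
Proof.
have pq := dist_ge0 p q; have qr := dist_ge0 q r.
rewrite -(@ler_pXn2r _ 2) ?nnegrE ?addr_ge0 ?dist_ge0//.
rewrite sqrrD !distE.
set a := p.1 - q.1; set b := p.2 - q.2; set c := q.1 - r.1; set d := q.2 - r.2.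
have -> : p.1 - r.1 = a + c by rewrite /a /c; lra.
have -> : p.2 - r.2 = b + d by rewrite /b /d; lra.
suff : a * c + b * d <= dist p q * dist q r by nra.
rewrite (le_trans (ler_norm _))//.
rewrite -(@ler_pXn2r _ 2) ?nnegrE ?mulr_ge0 ?normr_ge0//.
rewrite real_normK ?num_real// exprMn !distE -/a -/b -/c -/d.
rewrite -subr_ge0.
have -> : (a ^+ 2 + b ^+ 2) * (c ^+ 2 + d ^+ 2) - (a * c + b * d) ^+ 2
  = (a * d - b * c) ^+ 2 by lra.
exact: sqr_ge0.
Qed.

(** * Visit times of the vertices of one hexagon *)

(* Otherwise at least five vertices are visited before time [c + 2], which is
   impossible since each robot visits at most two; so two vertices [x] and [y]
   are visited at [c + 2] or later, say with [t x <= t y].  This forces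
   [t x < c + 1 + sqrt 3], hence the three vertices that are not adjacent to
   [x] are all visited before time [c + 1], two of them by the same robot. *)
Lemma hexagon_late_visit (R : realType) (d : 'I_6 -> 'I_6 -> R)
    (t : 'I_6 -> R) (rho : 'I_6 -> bool) (c B : R)
    (d_ge1 : forall i j, i != j -> 1 <= d i j)
    (d_far : forall i j : 'I_6, (i + 2 <= j <= i + 4)%N \/ (j + 2 <= i <= j + 4)%N ->
       Num.sqrt 3 <= d i j)
    (t_ge : forall i, c <= t i) (t_le : forall i, t i <= B)
    (t_same : forall i j, rho i = rho j -> d i j <= `|t i - t j|)
    (t_diff : forall i j, t i <= t j -> d i j <= t j - t i \/ t j + d i j <= B) :
  c + 2 + Num.sqrt 3 <= B.
Proof.
rewrite leNgt; apply/negP => Blt.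
have [s1 s2] : 1 <= Num.sqrt 3 :> R /\ Num.sqrt 3 <= 2 :> R.
  have s3 : Num.sqrt (3 : R) ^+ 2 = 3 by rewrite sqr_sqrtr//; lra.
  have s0 : 0 <= Num.sqrt (3 : R) by exact: sqrtr_ge0.
  by split; nra.
have same_lt1 i j : rho i = rho j -> `|t i - t j| < 1 -> i = j.
  move=> rij tij; apply/eqP; apply: contraT => /d_ge1 dij.
  by have := t_same _ _ rij; lra.
have [x [y [tx ty xy]]] : exists x y, [/\ c + 2 <= t x, c + 2 <= t y & x != y].
  pose L := [set i | c + 2 <= t i]%SET.
  suff /card_gt1P[x [y [+ + xy]]] : (1 < #|L|)%N.
    by rewrite !inE => tx ty; exists x, y.
  (* The second component splits the visits before [c + 2] into two unit intervals; one robot cannot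
     visit two vertices within less than one time unit. *)
  pose f i := (rho i, c + 1 <= t i).
  have inj : {in ~: L &, injective f}.
    move=> i j; rewrite !inE -!ltNge => ti tj [rij eij]; apply: same_lt1 => //.
    have := t_ge i; have := t_ge j; move: eij.
    by case: (leP (c + 1) (t i)) => ?; case: (leP (c + 1) (t j)) => // ? _ ? ?;
      rewrite ltr_norml; apply/andP; split; lra.
  have := cardsC L; rewrite card_ord -(card_in_imset inj).
  have : (#|f @: ~: L| <= 4)%N.
    by rewrite (leq_trans (max_card _))// card_prod card_bool.
  lia.
wlog txy : x y tx ty xy / t x <= t y.
  by move=> W; have [/W|/ltW /W] := leP (t x) (t y); apply; rewrite // eq_sym.
have tx_lt : t x < c + 1 + Num.sqrt 3.
  by have := d_ge1 _ _ xy; have := t_le y; case: (t_diff _ _ txy); lra.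
(* Since [c + 2 <= t x] and [B < c + 2 + sqrt 3], the only option that [t_diff] leaves is a visit of
   [w] at least [sqrt 3] before that of [x]. *)
have far_lt (w : 'I_6) :
    (x + 2 <= w <= x + 4)%N \/ (w + 2 <= x <= w + 4)%N -> t w < c + 1.
  move=> xw; have := d_far _ _ xw; have : Num.sqrt 3 <= d w x by apply: d_far; tauto.
  have [xw'|/ltW wx'] := leP (t x) (t w); have := t_le w.
    by case: (t_diff _ _ xw'); lra.
  by case: (t_diff _ _ wx'); lra.
(* The vertices not adjacent to [x]: [x + 2], [x + 3] and [x + 4] modulo 6. *)
pose g (k : 'I_3) : 'I_6 := inord ((x + 2 + k) %% 6).
have gE k : g k = ((x + 2 + k) %% 6)%N :> nat by rewrite inordK// ltn_mod.
have g_lt k : t (g k) < c + 1.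
  apply: far_lt; rewrite gE; have := ltn_ord x; have := ltn_ord k; lia.
have g_inj : injective (rho \o g).
  move=> k l /= /same_lt1 => kl; apply: val_inj => /=.
  have : g k = g l.
    apply: kl; have := t_ge (g k); have := t_ge (g l).
    have := g_lt k; have := g_lt l => ? ? ? ?.
    by rewrite ltr_norml; apply/andP; split; lra.
  move/(congr1 val); rewrite /= !gE.
  have := ltn_ord x; have := ltn_ord k; have := ltn_ord l; lia.
by have := leq_card _ g_inj; rewrite card_ord card_bool.
Qed.

(** * Chords of the unit circle *)

Definition cis (R : realType) (x : R) : point R := (cos x, sin x).

Lemma circle_cis (R : realType) (x : R) : circle (cis x).
Proof.
by rewrite /circle /= /dist /= !sub0r !sqrrN cos2Dsin2 sqrtr1.
Qed.

Lemma dist_cis (R : realType) (a b : R) :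
  dist (cis a) (cis b) = 2 * `|sin ((a - b) / 2)|.
Proof.
apply/eqP; rewrite -(@eqrXn2 _ 2) ?dist_ge0 ?mulr_ge0//.
rewrite distE exprMn real_normK ?num_real//=.
have ab : cos (a - b) = 1 - 2 * sin ((a - b) / 2) ^+ 2.
  have {1}-> : a - b = ((a - b) / 2) *+ 2 by rewrite mulr2n; lra.
  by rewrite cos_mulr2n cos2sin2 mulr2n; lra.
have := cos2Dsin2 a; have := cos2Dsin2 b; rewrite cosB in ab => ? ?.
by apply/eqP; lra.
Qed.

(** Half the angle lies in [[y / 2, pi - y / 2]], where the sine is smallest at the ends: it
    increases up to [pi / 2] and is symmetric about it. *)
Lemma chord_ge (R : realType) (y a b : R) : 0 <= y <= pi ->
  y <= `|a - b| <= 2 * pi - y -> 2 * sin (y / 2) <= dist (cis a) (cis b).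
Proof.
move=> /andP[y0 ypi].
wlog : a b / b <= a.
  by move=> W; have [/W//|/ltW/W] := leP b a; rewrite distC distrC.
move=> ba; rewrite ger0_norm ?subr_ge0// dist_cis => /andP[lo hi].
set x := (a - b) / 2; have x0 : y / 2 <= x <= pi - y / 2.
  by rewrite /x; apply/andP; split; lra.
rewrite ler_pM2l// (le_trans _ (ler_norm _))//.
have mono u v : 0 <= u -> u <= v -> v <= pi / 2 -> sin u <= sin v :> R.
  have := pi_ge0 R => ? ? ? ?; rewrite leNgt ltr_sin -?leNgt// in_itv /=;
  by apply/andP; split; lra.
have [xpi|xpi] := leP x (pi / 2); first by apply: mono; lra.
have -> : sin x = sin (pi - x) by rewrite sinB sinpi cospi; lra.
by apply: mono; lra.
Qed.

(** With [c = cos (pi / 3)], the triple-angle formula for [cos pi = -1] factors as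
    [(c + 1) (2 c - 1)^2 = 0], and [c > 0]. *)
Lemma cos_pi3 (R : realType) : cos (pi / 3) = 1 / 2 :> R.
Proof.
set x : R := pi / 3.
have c0 : 0 < cos x.
  by apply: cos_gt0_pihalf; rewrite /x; have := pi_gt0 R => ?; apply/andP; split; lra.
have E : cos (x *+ 2 + x) = -1 by rewrite -cospi; congr cos; rewrite /x mulr2n; lra.
rewrite cosD cos_mulr2n sin_mulr2n -mulrnAl -mulrA -expr2 sin2cos2 !mulr2n in E.
have : (cos x + 1) * (2 * cos x - 1) ^+ 2 = 0 by lra.
move/eqP; rewrite mulf_eq0 sqrf_eq0 => /orP[] /eqP; lra.
Qed.

Lemma sin_pi6 (R : realType) : sin (pi / 6) = 1 / 2 :> R.
Proof. by rewrite -cos_pi3 -cosBpihalf -cosN; congr cos; lra. Qed.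

Lemma sin_pi3 (R : realType) : sin (pi / 3) = Num.sqrt 3 / 2 :> R.
Proof.
have p0 := pi_gt0 R.
have s0 : 0 <= sin (pi / 3 : R) by apply: sin_ge0_pi; apply/andP; split; lra.
apply/eqP; rewrite -(@eqrXn2 _ 2) ?divr_ge0 ?sqrtr_ge0//.
by rewrite exprMn sqr_sqrtr// sin2cos2 cos_pi3; apply/eqP; lra.
Qed.

(** * Hexagons left unvisited for long *)

(** The mean value theorem is used twice, for the sine and then for the cosine at the intermediate
    point. *)
Lemma sin_ge_quadratic (R : realType) (x : R) : 0 <= x -> x * (1 - x) <= sin x.
Proof.
move=> x0.
have [|c] := @MVT_segment R sin cos _ _ x0.
  exact/continuous_subspaceT/continuous_sin.
rewrite in_itv /= => /andP[c0 cx]; rewrite sin0 !subr0 => ->.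
have [|e _] := @MVT_segment R cos (- sin) _ _ c0.
  exact/continuous_subspaceT/continuous_cos.
rewrite cos0 subr0 => ce; have {}ce : cos c - 1 = - (sin e * c) by rewrite ce -mulNr.
have e1 := sin_le1 e.
have : 1 - c <= cos c by nra.
by move=> ?; rewrite mulrC ler_wpM2r//; lra.
Qed.

(** As [n] grows, [n] times the side of the regular [6 (2 n + 1)]-gon tends to [pi / 6 > h]. *)
Lemma slot_size_exists (R : realType) (h : R) : 0 < h < pi / 6 ->
  exists2 n, (0 < n)%N & h / n%:R < 2 * sin (pi / 6 / (2 * n + 1)%:R).
Proof.
move=> /andP[h0 hp]; set p : R := pi / 6 in hp *.
have p1 : p <= 1 by rewrite /p; have := pihalf_lt2 R; lra.
(* Any [n > 1 / (pi / 6 - h)] is large enough. *)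
set z := (p - h)^-1; have z0 : 0 < z by rewrite invr_gt0; lra.
exists (Num.bound z); first by rewrite -(ltr_nat R) (lt_trans z0)// archi_boundP// ltW.
have := archi_boundP (ltW z0); set n := Num.bound z => zn.
have zE : z * (p - h) = 1 by rewrite mulVf; lra.
clearbody z n; set N := n%:R : R in zn *.
have N0 : 0 < N by lra.
have -> : (2 * n + 1)%:R = 2 * N + 1 :> R by rewrite natrD natrM.
set x := p / (2 * N + 1).
have xE : x * (2 * N + 1) = p by rewrite divfK//; lra.
have x0 : 0 <= x by rewrite divr_ge0//; lra.
apply: lt_le_trans (_ : 2 * (x * (1 - x)) <= _); last first.
  by rewrite ler_pM2l// sin_ge_quadratic.
rewrite ltr_pdivrMr//.
have Nph : 1 < N * (p - h) by nra.
have x1 : x <= 1 by nra.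
have Nx : N * x <= 1 / 2 by nra.
nra.
Qed.

(* For a suitable large [M = 2 n + 1], the [6 M] vertices of a regular polygon
   form [M] hexagons, and two of these vertices visited by the same robot
   during the same of [n] equal time slots covering [1, c] would be closer than
   two neighbouring vertices.  Hence at most [2 n < M] of the hexagons have a
   vertex visited before time [c]. *)
Lemma unvisited_hexagon (R : realType) (tau : point R -> R)
    (rho : point R -> bool) (c : R)
    (tau_ge1 : forall e, circle e -> 1 <= tau e)
    (tau_same : forall e f, circle e -> circle f -> rho e = rho f ->
       dist e f <= `|tau e - tau f|) :
  c < 1 + pi / 6 ->
  exists a, forall k : 'I_6, c <= tau (cis (a + k%:R * (pi / 3))).
Proof.
move=> c_lt; have [c_le1|c_gt1] := leP c 1.
  by exists 0 => k; rewrite (le_trans c_le1)// tau_ge1//; exact: circle_cis.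
have [n n0 slot] : exists2 n, (0 < n)%N &
    (c - 1) / n%:R < 2 * sin (pi / 6 / (2 * n + 1)%:R).
  by apply: slot_size_exists; lra.
set M := (2 * n + 1)%N in slot.
set s : R := pi / 3 / M%:R; set d := (c - 1) / n%:R in slot.
have M0 : 0 < M%:R :> R by rewrite ltr0n /M addn1.
have n0R : 0 < n%:R :> R by rewrite ltr0n.
have d0 : 0 < d by rewrite divr_gt0// subr_gt0.
have Ms : M%:R * s = pi / 3 by rewrite mulrC divfK// gt_eqF.
have s0 : 0 < s by rewrite !divr_gt0// pi_gt0.
have spi : s <= pi.
  have : 1 <= M%:R :> R by rewrite ler1n /M addn1.
  by have := pi_gt0 R; nra.
have polygon (i j : nat) : (i < 6 * M)%N -> (j < 6 * M)%N -> i != j ->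
    d < dist (cis (i%:R * s)) (cis (j%:R * s)).
  wlog ij : i j / (j < i)%N.
    by move=> W iM jM; rewrite neq_lt => /orP[] ?; [rewrite distC|]; apply: W;
      rewrite // neq_lt; apply/orP; tauto.
  move=> iM _ _; apply: lt_le_trans slot _.
  have -> : pi / 6 / M%:R = s / 2 :> R by rewrite /s; lra.
  apply: chord_ge; first by apply/andP; split; lra.
  rewrite -mulrBl ger0_norm; last by rewrite mulr_ge0 ?subr_ge0 ?ler_nat ?(ltnW ij)// ltW.
  have : j%:R + 1 <= i%:R :> R by rewrite natr1 ler_nat.
  have : i%:R + 1 <= 6 * M%:R :> R by rewrite -natrM natr1 ler_nat.
  have : 0 <= j%:R :> R by rewrite ler0n.
  by move=> ? ? ?; apply/andP; split; nra.
apply: contrapT => /forallNP none.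
(* Each hexagon [i] gets an early vertex; its index in the polygon is [i + k M], as [M] steps of
   angle [s] make [pi / 3]. *)
have /choice[k early] : forall i : 'I_M, exists k : 'I_6,
    tau (cis ((i + k * M)%N%:R * s)) < c.
  move=> i; have /existsNP[k /negP] := none (i%:R * s).
  rewrite -ltNge => early; exists k.
  by rewrite natrD natrM mulrDl -mulrA Ms.
pose e (i : 'I_M) := cis ((i + k i * M)%N%:R * s).
have e_circle i : circle (e i) by exact: circle_cis.
pose slot_of i := Num.truncn ((tau (e i) - 1) / d).
have slotP i : 
      (slot_of i)%:R * d <= tau (e i) - 1 < ((slot_of i)%:R + 1) * d.
  rewrite natr1 -ler_pdivlMr// -ltr_pdivrMr//.
  by apply: truncn_itv; rewrite divr_ge0 ?subr_ge0 ?tau_ge1// ltW.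
have slot_lt i : (slot_of i < n)%N.
  rewrite truncn_lt_nat; last by rewrite divr_ge0 ?subr_ge0 ?tau_ge1// ltW.
  rewrite ltr_pdivrMr// mulrC divfK ?gt_eqF// ltrD2r.
  exact: early.
pose F i := (rho (e i), Ordinal (slot_lt i)).
have F_inj : injective F.
  move=> i j [rij sij]; apply: contrapT => ij.
  have := tau_same _ _ (e_circle i) (e_circle j) rij; apply/negP; rewrite -ltNge.
  apply: (@le_lt_trans _ _ d); last first.
    have := ltn_ord i; have := ltn_ord j.
    have := ltn_ord (k i); have := ltn_ord (k j) => kj ki jM iM.
    apply: polygon; [nia | nia |].
    (* The index modulo [M] recovers the hexagon. *)
    apply/eqP => E; apply: ij; apply: val_inj => /=.
    have : ((k i * M + i) %% M = (k j * M + j) %% M)%N by rewrite addnC E addnC.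
    by rewrite !modnMDl !modn_small.
  have := slotP i; have := slotP j; rewrite -sij => /andP[j1 j2] /andP[i1 i2].
  by rewrite ler_norml; apply/andP; split; lra.
have := leq_card _ F_inj; rewrite card_prod card_bool !card_ord /M; lia.
Qed.

(** * The bound in terms of visit times alone *)

Lemma hexagon_dist (R : realType) (a : R) (i j : 'I_6) :
  let q (k : 'I_6) := cis (a + k%:R * (pi / 3)) in
  (i != j -> 1 <= dist (q i) (q j)) /\
  ((i + 2 <= j <= i + 4)%N \/ (j + 2 <= i <= j + 4)%N ->
    Num.sqrt 3 <= dist (q i) (q j)).
Proof.
move=> q; have p0 := pi_gt0 R.
wlog ij : i j / (j <= i)%N.
  move=> W; have [/W//|/ltnW/W[W1 W2]] := leqP j i.
  by split=> H; rewrite distC; [apply: W1; rewrite eq_sym | apply: W2; tauto].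
have ijE : `|a + i%:R * (pi / 3) - (a + j%:R * (pi / 3))| = (i - j)%:R * (pi / 3).
  have : j%:R <= i%:R :> R by rewrite ler_nat.
  by move=> ?; rewrite natrB// ger0_norm; nra.
split=> H.
  have -> : 1 = 2 * sin (pi / 3 / 2) :> R.
    by have -> : pi / 3 / 2 = pi / 6 :> R; [lra | rewrite sin_pi6; lra].
  apply: chord_ge; first by apply/andP; split; lra.
  have lo : 1 <= (i - j)%:R :> R by rewrite ler1n subn_gt0 ltn_neqAle eq_sym H.
  have hi : (i - j)%:R <= 5 :> R by rewrite ler_nat; have := ltn_ord i; lia.
  by rewrite ijE; apply/andP; split; nra.
have -> : Num.sqrt 3 = 2 * sin (2 * (pi / 3) / 2) :> R.
  by have -> : 2 * (pi / 3) / 2 = pi / 3 :> R; [lra | rewrite sin_pi3; lra].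
apply: chord_ge; first by apply/andP; split; lra.
have lo : 2 <= (i - j)%:R :> R by rewrite ler_nat; lia.
have hi : (i - j)%:R <= 4 :> R by rewrite ler_nat; lia.
by rewrite ijE; apply/andP; split; nra.
Qed.

Lemma visit_time_bound (R : realType) (tau : point R -> R)
    (rho : point R -> bool) (B : R)
    (tau_ge1 : forall e, circle e -> 1 <= tau e)
    (tau_le : forall e, circle e -> tau e <= B)
    (tau_same : forall e f, circle e -> circle f -> rho e = rho f ->
       dist e f <= `|tau e - tau f|)
    (tau_diff : forall e f, circle e -> circle f -> tau e <= tau f ->
       dist e f <= tau f - tau e \/ tau f + dist e f <= B) :
  3 + pi / 6 + Num.sqrt 3 <= B.
Proof.
apply/ler_addgt0Pr => eps eps0.
(* The loss of [eps] keeps [c] strictly below [1 + pi / 6]. *)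
have [|a late] := @unvisited_hexagon R tau rho (1 + pi / 6 - eps) tau_ge1 tau_same.
  by lra.
pose q (k : 'I_6) := cis (a + k%:R * (pi / 3)).
have qC k : circle (q k) by exact: circle_cis.
have := @hexagon_late_visit R (fun i j => dist (q i) (q j)) (tau \o q) (rho \o q)
  (1 + pi / 6 - eps) B (fun i j => (hexagon_dist a i j).1)
  (fun i j => (hexagon_dist a i j).2) late (fun i => tau_le _ (qC i))
  (fun i j => tau_same _ _ (qC i) (qC j)) (fun i j => tau_diff _ _ (qC i) (qC j)).
by lra.
Qed.

(** * Indistinguishable runs *)

Section Runs.
Context {R : realType}.
Implicit Types (r : motion R) (e p q : point R) (s : robot -> strategy R).

Lemma dist_small p q : (forall eps : R, 0 < eps -> dist p q <= eps) -> p = q.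
Proof. by move=> small; apply/dist_eq0/ler_addgt0Pr => eps /small; rewrite add0r. Qed.

Lemma meet_eq r (t : R) : meet_at r t -> forall i j, r i t = r j t.
Proof. by move=> [_ rt] [] []. Qed.

(** Continuous induction on the supremum [m] of the times of agreement: unit speed carries agreement
    to [m], and equal knowledge at [m] gives equal plans for a while longer. The set [J] allows
    following one robot after the other has diverged. *)
Lemma agreement_extends s e e' r r' (J : robot -> Prop) (a b : R) :
    execution s e r -> execution s e' r' ->
    (forall i, J i -> forall u, 0 <= u <= a -> r i u = r' i u) ->
    (forall t, 0 <= t -> a <= t < b ->
      (forall i, J i -> forall u, 0 <= u <= t -> r i u = r' i u) ->
      forall i, J i -> knowledge_at e r i t = knowledge_at e' r' i t) ->
  forall i, J i -> forall u, 0 <= u <= b -> r i u = r' i u.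
Proof.
move=> ex ex'; pose agree t := forall i, J i -> forall u, 0 <= u <= t -> r i u = r' i u.
rewrite -/(agree a) -/(agree b) => agree_a same_knowledge.
(* A negative [a] may be replaced by 0, where both runs are at the origin. *)
wlog a0 : a agree_a same_knowledge / 0 <= a.
  move=> W; have [a0|a0] := leP 0 a; first exact: (W a).
  apply: (W 0) => // [i _ u /andP[u0 ul]|t t0 /andP[_ tb]].
    have -> : u = 0 by apply/eqP; rewrite eq_le ul u0.
    by have [-> _ _ _] := ex i; have [-> _ _ _] := ex' i.
  by apply: same_knowledge => //; rewrite tb (le_trans (ltW a0)).
have [ba|ab] := leP b a.
  by move=> i Ji u /andP[u0 ub]; apply: agree_a; rewrite // u0 (le_trans ub).
pose S : set R := [set t | a <= t <= b /\ agree t].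
have Sa : S a by split=> //; rewrite lexx ltW.
have S_sup : has_sup S by split; [exists a | exists b; move=> t [/andP[]]].
set m := sup S; have am : a <= m by apply: sup_upper_bound.
have mb : m <= b by apply: ge_sup; [exists a | move=> t [/andP[]]].
have m0 : 0 <= m by apply: le_trans am.
have agree_m : agree m.
  move=> i Ji u /andP[u0]; rewrite le_eqVlt => /predU1P[->|um]; last first.
    have := sup_adherent (_ : 0 < m - u) S_sup.
    rewrite subr_gt0 => /(_ um)[t [_ agr]]; rewrite subKr => ut.
    by apply: agr; rewrite // u0 ltW.
  apply: dist_small => eps eps0.
  have [|t St mt] := @sup_adherent _ S (eps / 2) _ S_sup; first by lra.
  have tm : t <= m by apply: sup_upper_bound.
  have [/andP[at_ _] agr] := St; rewrite -/m in mt.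
  have t0 : 0 <= t by apply: le_trans at_.
  have rt : r i t = r' i t by apply: agr => //; rewrite t0 lexx.
  have [_ _ lip _] := ex i; have [_ _ lip' _] := ex' i.
  rewrite (le_trans (dist_triangle (r i t) _ _))// {2}rt.
  have := lip m t m0 t0; have := lip' t m t0 m0.
  by rewrite (distrC t m) ger0_norm; lra.
suff -> : b = m by [].
apply/eqP; rewrite eq_le mb andbT leNgt; apply/negP => m_lt_b.
have step i : exists2 d : R, 0 < d &
    J i -> forall u, m <= u <= m + d -> r i u = r' i u.
  have [_ _ _ /(_ m m0)[d d0 obey]] := ex i.
  have [_ _ _ /(_ m m0)[d' d0' obey']] := ex' i.
  exists (Num.min d d'); first by rewrite lt_min d0.
  move=> Ji u /andP[mu]; rewrite -lerBlDl le_min !lerBlDl => /andP[ud ud'].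
  rewrite obey ?mu// obey' ?mu// (same_knowledge m m0)//.
  by rewrite am.
have [d d0 stepd] : exists2 d : R, 0 < d &
    forall i, J i -> forall u, m <= u <= m + d -> r i u = r' i u.
  have [d d0 sd] := step true; have [d' d0' sd'] := step false.
  exists (Num.min d d'); first by rewrite lt_min d0.
  move=> i Ji u /andP[mu]; rewrite -lerBlDl le_min !lerBlDl => /andP[ud ud'].
  by case: i Ji => Ji; [apply: sd | apply: sd']; rewrite // mu.
have : S (Num.min b (m + d)).
  split; first by rewrite le_min ge_min lexx (ltW ab)/=; lra.
  move=> i Ji u /andP[u0]; rewrite le_min => /andP[_ ud].
  have [um|/ltW mu] := leP u m; first by apply: agree_m; rewrite // u0.
  by apply: stepd; rewrite // mu.
move=> /(sup_upper_bound S_sup); rewrite -/m leNgt lt_min m_lt_b /=.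
by rewrite ltrDl d0.
Qed.

Definition first_visit e r (i : robot) (t : R) : Prop :=
  [/\ 0 <= t, r i t = e & forall j u, 0 <= u -> r j u = e -> t <= u].

(** The infimum of the visit times is attained: otherwise both robots are at positive distance from
    [e] at that time, and unit speed keeps them away for a while. *)
Lemma first_visit_exists s e r (i : robot) (t : R) :
  execution s e r -> finds_at e r i t -> exists j u, first_visit e r j u.
Proof.
move=> ex [t0 it]; pose S : set R := [set u | exists j, finds_at e r j u].
have S_inf : has_inf S by split; [exists t, i | exists 0 => u [j []]].
set m := inf S; have m_le j u : 0 <= u -> r j u = e -> m <= u.
  by move=> u0 ju; apply: ge_inf; [exact: S_inf.2 | exists j].
have m0 : 0 <= m by apply: lb_le_inf; [exact: S_inf.1 | move=> u [j []]].
suff [j jm] : exists j, r j m = e by exists j, m; split.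
apply: contrapT => /forallNP away.
have pos j : 0 < dist (r j m) e by rewrite ltNge; apply/negP => /dist_eq0/away.
have [|u [j [u0 ju]]] := @inf_adherent _ S
    (Num.min (dist (r true m) e) (dist (r false m) e)) _ S_inf.
  by rewrite lt_min !pos.
rewrite -/m -ltrBlDl lt_min => /andP[um um'].
have [_ _ /(_ m u m0 u0) + _] := ex j.
rewrite ju distrC ger0_norm ?subr_ge0 ?(m_le j)// leNgt => /negP; apply.
by case: j {ju}.
Qed.

Definition uninformed e r (i : robot) (t : R) : Prop :=
  (forall u, 0 <= u <= t -> r i u <> e) /\
  (forall j u m, meet_at r m -> 0 <= u <= m -> m <= t -> r j u <> e).

(** Without any sighting, knowledge reduces to the meeting times. *)
Lemma uninformed_knowledge_eq e e' r r' (i : robot) (t : R) :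
    uninformed e r i t -> uninformed e' r' i t ->
    (forall m, m <= t -> meet_at r m <-> meet_at r' m) ->
  knowledge_at e r i t = knowledge_at e' r' i t.
Proof.
have blind f r0 : uninformed f r0 i t -> sightings (knowledge_at f r0 i t) = set0.
  move=> [own told]; apply/seteqP; split=> // -[[j u] p] /=.
  move=> [_ [u0 jf] [[ij ut]|[m [mm um mt]]]].
    by apply: (own u); rewrite ?u0// -ij.
  by apply: (told j u m); rewrite ?u0.
move=> /blind + /blind + same; rewrite /knowledge_at /= => -> ->.
by congr Knowledge; apply/seteqP; split=> m [mm mt]; split=> //; apply/same.
Qed.

Lemma agree_meet_at r r' (b : R) :
  (forall i u, 0 <= u <= b -> r i u = r' i u) ->
  forall m, m <= b -> meet_at r m <-> meet_at r' m.
Proof.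
move=> agree m mb; split=> -[m0]; rewrite /meet_at -?agree ?m0//;
  by rewrite !agree ?m0.
Qed.

(** Before time [t] neither exit has been seen in its own run, so the robots only know of their
    meetings, which coincide. *)
Lemma runs_agree s e f r r' (i j : robot) (t u : R) :
    execution s e r -> execution s f r' ->
    first_visit e r i t -> first_visit f r' j u -> t <= u ->
  forall k w, 0 <= w <= t -> r k w = r' k w.
Proof.
move=> ex ex' [t0 it t_first] [u0 ju u_first] tu k.
apply: (agreement_extends (J := fun=> True) (a := 0) ex ex') => // [k' _ w|x x0].
  move=> /andP[w0 w0']; have -> : w = 0 by apply/eqP; rewrite eq_le w0 w0'.
  by have [-> _ _ _] := ex k'; have [-> _ _ _] := ex' k'.
move=> /andP[_ xt] agree k' _; apply: uninformed_knowledge_eq.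
- split=> [w /andP[w0 wx] | l w m _ /andP[w0 wm] mx] /t_first; lra.
- split=> [w /andP[w0 wx] | l w m _ /andP[w0 wm] mx] /u_first; lra.
- by apply: agree_meet_at => l w; apply: agree.
Qed.

(** In the run with exit [f], robot [i] is at [e] at time [t] by agreement, and at [f] at time
    [u]. *)
Lemma same_finder_dist s e f r r' (i : robot) (t u : R) :
    execution s e r -> execution s f r' ->
    first_visit e r i t -> first_visit f r' i u -> t <= u ->
  dist e f <= u - t.
Proof.
move=> ex ex' vt vu tu; have agree := runs_agree ex ex' vt vu tu.
have [[t0 it _] [u0 iu _]] := (vt, vu); have [_ _ lip _] := ex' i.
by have := lip t u t0 u0; rewrite iu -agree ?t0 ?lexx// it distrC ger0_norm ?subr_ge0.
Qed.

(** If [f] is too far, robot [j] cannot learn of [e] by time [u], so it is at [f] at that time in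
    both runs and still has to travel to [e]. *)
Lemma late_or_reachable s e f r r' (i j : robot) (t u v : R) :
    execution s e r -> execution s f r' ->
    first_visit e r i t -> first_visit f r' j u -> t <= u ->
    finds_at e r j v ->
  dist e f <= u - t \/ u + dist e f <= v.
Proof.
move=> ex ex' vt vu tu [v0 jv].
have agree := runs_agree ex ex' vt vu tu.
have [[t0 it t_first] [u0 ju u_first]] := (vt, vu).
have [|far] := leP (dist e f) (u - t); [by left | right].
have [_ _ lipj _] := ex j; have [_ _ lip'j _] := ex' j.
have [_ _ lip'i _] := ex' i; have [_ _ lipi _] := ex i.
have it' : r' i t = e by rewrite -agree ?t0 ?lexx.
(* Otherwise the path from [e] through [q] to [f] would fit between the times [t] and [u]. *)
have apart x q : t <= x <= u -> dist e q <= x - t -> r' j x = q -> False.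
  move=> /andP[tx xu] eq jx; have x0 : 0 <= x by lra.
  have := lip'j x u x0 u0; rewrite jx ju distrC ger0_norm ?subr_ge0// => qf.
  by have := dist_triangle q e f; lra.
have no_meeting' m : t <= m <= u -> ~ meet_at r' m.
  move=> tmu mm; apply: (apart m (r' i m)) => //; last by rewrite (meet_eq mm i j).
  have [tm _] := andP tmu; have := lip'i t m t0 (le_trans t0 tm).
  by rewrite it' distrC ger0_norm ?subr_ge0.
(* Only [j] is followed beyond [t]: with exit [e], robot [i] is informed from then on. *)
have agree_j : forall w, 0 <= w <= u -> r j w = r' j w.
  apply: (agreement_extends (J := fun k => k = j) (a := t) ex ex') => // [k -> |x x0].
    exact: agree.
  move=> /andP[tx xu] agree_x k ->.
  have no_meeting m : t <= m <= x -> ~ meet_at r m.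
    move=> /andP[tm mx] mm; have m0 := le_trans t0 tm.
    apply: (apart m (r i m)); first by rewrite tm (le_trans mx (ltW xu)).
      by have := lipi t m t0 m0; rewrite it distrC ger0_norm ?subr_ge0.
    by rewrite (meet_eq mm i j) agree_x ?m0.
  apply: uninformed_knowledge_eq.
  - split=> [w /andP[w0 wx] jw|l w m mm /andP[w0 wm] mx lw].
      have tw := t_first _ _ w0 jw.
      apply: (apart w e); rewrite -?agree_x ?w0 ?distxx ?subr_ge0//.
      by rewrite tw (le_trans wx (ltW xu)).
    by apply: (no_meeting m _ mm); rewrite mx (le_trans (t_first _ _ w0 lw) wm).
  - split=> [w /andP[w0 wx] | l w m _ /andP[w0 wm] mx] /u_first; lra.
  - move=> m mx; have [tm|/ltW mt] := leP t m; last exact: (agree_meet_at agree).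
    split=> mm; exfalso; first by apply: (no_meeting m); rewrite ?tm.
    by apply: (no_meeting' m); rewrite ?tm ?(le_trans mx (ltW xu)).
have [vu'|uv] := leP v u; last first.
  have := lipj u v u0 v0; rewrite jv agree_j ?u0 ?lexx// ju.
  by rewrite distC distrC ger0_norm ?subr_ge0 ?(ltW uv)// lerBrDl.
exfalso; have tv := t_first _ _ v0 jv.
by apply: (apart v e); rewrite -?agree_j ?v0 ?distxx ?subr_ge0// tv.
Qed.

End Runs.

(** * From runs to the worst-case evacuation time *)

Lemma evacuated_before (R : realType) (A : algorithm R) (B : R) (e : point R) :
  (worst_case_time A < B%:E)%E -> circle e ->
  forall i, exists2 t, t <= B & finds_at e (motion_of A e) i t.
Proof.
move=> worst ce i.
have : (evacuation_time e (motion_of A e) < B%:E)%E.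
  by apply: le_lt_trans worst; apply: ereal_sup_ubound; exists e.
move=> /ereal_inf_lt[_ [T evac <-]]; rewrite lte_fin => TB.
by have [t tT found] := evac i; exists t => //; rewrite (le_trans tT) ?ltW.
Qed.

Theorem theorem3 (R : realType) (A : algorithm R) :
  ((3 + pi / 6 + Num.sqrt 3)%R%:E <= worst_case_time A)%E.
Proof.
suff bound B : (worst_case_time A < B%:E)%E -> 3 + pi / 6 + Num.sqrt 3 <= B.
  case: (worst_case_time A) bound => [w| |] bound; last 2 first.
  - exact: leey.
  (* The value [-oo] would make the bound hold for every real [B]. *)
  - by exfalso; have := bound (3 + pi / 6 + Num.sqrt 3 - 1) (ltNyr _); lra.
  - rewrite lee_fin; apply/ler_addgt0Pr => eps eps0.
    by apply: bound; rewrite lte_fin ltrDl.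
move=> /evacuated_before evac.
have run e : circle e -> execution (strategy_of A) e (motion_of A e).
  exact: motion_ofP.
have /choice[x xP] : forall e, exists x : robot * R, circle e ->
    first_visit e (motion_of A e) x.1 x.2.
  (* The pair [(true, 0)] is a dummy value off the circle. *)
  move=> e; have [ce|nce] := pselect (circle e); last by exists (true, 0).
  have [t _ /(first_visit_exists (run e ce))[j [u vu]]] := evac e ce true.
  by exists (j, u).
apply: (@visit_time_bound R (fun e => (x e).2) (fun e => (x e).1))
  => [e ce|e ce|e f ce cf|e f ce cf].
- have [t0 at_e _] := xP e ce; have [at0 _ lip _] := run e ce (x e).1.
  have := lip 0 _ (lexx 0) t0; rewrite at0 at_e sub0r normrN ger0_norm//.
  by rewrite (ce : dist origin e = 1).
- have [_ _ first] := xP e ce; have [t tB [t0 te]] := evac e ce true.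
  by rewrite (le_trans (first _ _ t0 te)).
- wlog : e f ce cf / (x e).2 <= (x f).2.
    move=> W ef; have [/W|/ltW/W] := leP (x e).2 (x f).2; first exact.
    by rewrite distC distrC; apply.
  move=> le_ef ef; rewrite distrC ger0_norm ?subr_ge0//.
  have := xP e ce; rewrite ef => ve.
  exact: (same_finder_dist (run e ce) (run f cf) ve (xP f cf)).
- move=> le_ef; have [v vB found] := evac e ce (x f).1.
  have [|uv] := late_or_reachable (run e ce) (run f cf) (xP e ce) (xP f cf) le_ef found.
    by left.
  by right; rewrite (le_trans uv).
Qed.
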